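(* For each $T\in\mathbb{N}$ let $\{x_T(t)\}_{t\ge 0}$ be an optimal solution of the horizon-$T$ problem. Assume that for every $t\ge 0$ the limit $x^\circ(t):=\lim_{T\to\infty}x_T(t)$ exists, and that $\lim_{T\to\infty}\sum_{t=0}^{T}v\big(x^\circ(t),x^\circ(t+1),t\big)$ exists and is either $+\infty$ or a finite value. Suppose that $$\lim_{T\to\infty}\sum_{t=0}^{T}\Big(v\big(x_T(t),x_T(t+1),t\big)-v\big(\tilde x^{\circ T}(t),\tilde x^{\circ T}(t+1),t\big)\Big)=0 .$$ Then no attainable path overtakes $\{x^\circ(t)\}$ in the sense of the modified overtaking criterion; that is, for every attainable path $\{x_1(t)\}$, $$\liminf_{T\to\infty}\left(\sum_{t=0}^{T}v\big(\tilde x_1^{T}(t),\tilde x_1^{T}(t+1),t\big)-\sum_{t=0}^{T}v\big(\tilde x^{\circ T}(t),\tilde x^{\circ T}(t+1),t\big)\right)\le 0 .$$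
   Context: Infinite horizon problem: ''maximize'' $\sum_{t=0}^{\infty}v(x(t),x(t+1),t)$ subject to $x(0)=x_0$ and $\{x(t)\}_{t\ge 0}\in X$, where $x_0\in\mathbb{R}$ is given, $X\subset\mathbb{R}^{\infty}$ is a given set of real sequences, and $v$ is an extended real-valued function of $(x,y,t)\in\mathbb{R}\times\mathbb{R}\times\mathbb{N}$ with values in $[-\infty,\infty)$. The infinite sum need not be finite. An infinite sequence $\{x(t)\}_{t\ge 0}$ is attainable if $x(0)=x_0$ and $\{x(t)\}\in X$. Conversion (goods are not wasted: at the terminal time $T$ everything is used up): for a sequence $\{x(t)\}$ and $T\in\mathbb{N}$, put $\tilde x^{T}(t)=x(t)$ for $0\le t\le T$ and $\tilde x^{T}(t)=0$ for $t\ge T+1$. In particular $\tilde x^{\circ T}$ is the conversion of $x^\circ$. Standing assumption (reversible investment): if $\{x(t)\}$ is attainable, then so is $\{\tilde x^{T}(t)\}$ for every $T$. Horizon-$T$ problem: maximize $\sum_{t=0}^{T}v(x(t),x(t+1),t)$ over the sequences $\{x(t)\}\in X$ with $x(0)=x_0$ and $x(t)=0$ for all $t\ge T+1$. Modified overtaking criterion: $\{x_2(t)\}$ overtakes $\{x_1(t)\}$ if $$\liminf_{T\to\infty}\left(\sum_{t=0}^{T}v(\tilde x_2^T(t),\tilde x_2^T(t+1),t)-\sum_{t=0}^{T}v(\tilde x_1^T(t),\tilde x_1^T(t+1),t)\right)>0 .$$ The terms of the sum in the limit hypothesis are understood to be differences of finite numbers. *)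

(* Defs.v *)
From mathcomp Require Import all_boot all_order all_algebra.
From mathcomp Require Import all_classical all_reals all_analysis.

Set Implicit Arguments.
Unset Strict Implicit.
Unset Printing Implicit Defensive.

Import Order.TTheory GRing.Theory Num.Theory.
Import numFieldNormedType.Exports.

Local Open Scope classical_set_scope.
Local Open Scope ring_scope.

Definition attainable (R : realType) (X : set (nat -> R)) (x0 : R)
    (x : nat -> R) : Prop :=
  X x /\ x 0%N = x0.

Definition conversion (R : realType) (x : nat -> R) (T : nat) : nat -> R :=
  fun t => if (t <= T)%N then x t else 0.

(* The horizon is inclusive: the sum has the T.+1 terms t = 0, ..., T, and its
   last term involves x T.+1. *)
Definition payoff (R : realType) (v : R -> R -> nat -> \bar R)
    (x : nat -> R) (T : nat) : \bar R :=
  (\sum_(0 <= t < T.+1) v (x t) (x t.+1) t)%E.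

Definition feasible (R : realType) (X : set (nat -> R)) (x0 : R) (T : nat)
    (x : nat -> R) : Prop :=
  attainable X x0 x /\ forall t, (T.+1 <= t)%N -> x t = 0.

Definition optimal (R : realType) (v : R -> R -> nat -> \bar R)
    (X : set (nat -> R)) (x0 : R) (T : nat) (x : nat -> R) : Prop :=
  feasible X x0 T x /\
  forall y, feasible X x0 T y -> (payoff v y T <= payoff v x T)%E.

(* The payoffs take values in [-oo, +oo[.  The subtraction is that of \bar R,
   in which -oo - -oo = -oo; it is meaningful as soon as the payoffs of the
   converted x1 are finite. *)
Definition overtakes (R : realType) (v : R -> R -> nat -> \bar R)
    (x2 x1 : nat -> R) : Prop :=
  (0 < limn_einf (fun T => payoff v (conversion x2 T) T
                           - payoff v (conversion x1 T) T))%E.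

(* Main.v *)
(** For each [T] the conversion of [x1] is feasible in the horizon-[T] problem, so
    its payoff is at most that of [xopt T]; subtracting the payoff of the
    conversion of [xo] bounds the overtaking difference by the [T]-th term of
    [diff_cvg0], which tends to [0]. *)
Require Import Defs.
From mathcomp Require Import all_boot all_order all_algebra.
From mathcomp Require Import all_classical all_reals all_analysis.

Import Order.TTheory GRing.Theory Num.Theory.
Import numFieldNormedType.Exports.

Local Open Scope classical_set_scope.
Local Open Scope ring_scope.

(** The lower limit is the limit of the tail infima, which are nondecreasing and so always converge
    in [\bar R]. It is enough to compare tails: each [w k] dominates [u k], a member of the same
    tail of [u]. *)
Lemma le_limn_einf (R : realType) (u w : nat -> \bar R) :
  (forall n, (u n <= w n)%E) -> (limn_einf u <= limn_einf w)%E.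
Proof.
move=> le_uw; rewrite !limn_einf_lim.
apply: lee_lim; [exact: is_cvg_einfs|exact: is_cvg_einfs|].
apply: nearW => n; apply: le_ereal_inf_tmp => _ [k /= le_nk <-].
by apply: ge_ereal_inf; exists (u k) => //; exists k.
Qed.

(** Finiteness of [g] lets the opposite pass through the sum, where infinities of both signs could
    otherwise meet; [f] may be infinite. *)
Lemma sum_natB_fin_num (R : realType) (n : nat) (f g : nat -> \bar R) :
  (forall t, (t < n)%N -> g t \is a fin_num) ->
  (\sum_(0 <= t < n) (f t - g t)
   = \sum_(0 <= t < n) f t - \sum_(0 <= t < n) g t)%E.
Proof.
by move=> g_fin; rewrite !big_mkord big_split fin_num_sumeN// => i _; exact: g_fin.
Qed.

Lemma feasible_conversion (R : realType) (X : set (nat -> R)) (x0 : R)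
    (x : nat -> R) (T : nat) :
  attainable X x0 (conversion x T) -> feasible X x0 T (conversion x T).
Proof. by split=> // t; rewrite /conversion ltnNge => /negbTE ->. Qed.

Theorem theorem1 (R : realType) (X : set (nat -> R)) (x0 : R)
    (v : R -> R -> nat -> \bar R)
    (v_lty : forall x y t, (v x y t < +oo)%E)
    (reversible : forall x, attainable X x0 x ->
       forall T, attainable X x0 (conversion x T))
    (xopt : nat -> nat -> R)
    (xopt_optimal : forall T, optimal v X x0 T (xopt T))
    (xo : nat -> R)
    (xopt_cvg : forall t, (fun T => xopt T t) @ \oo --> xo t)
    (payoff_cvg : exists2 l : \bar R,
       l != -oo%E & (fun T => payoff v xo T) @ \oo --> l)
    (xopt_fin : forall T t, (t <= T)%N ->
       v (xopt T t) (xopt T t.+1) t \is a fin_num)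
    (xo_fin : forall T t, (t <= T)%N ->
       v (conversion xo T t) (conversion xo T t.+1) t \is a fin_num)
    (diff_cvg0 : (fun T => (\sum_(0 <= t < T.+1)
         (v (xopt T t) (xopt T t.+1) t
          - v (conversion xo T t) (conversion xo T t.+1) t))%E)
       @ \oo --> 0%E) :
  forall x1, attainable X x0 x1 ->
    ~ overtakes v x1 xo /\
    (limn_einf (fun T => payoff v (conversion x1 T) T
                         - payoff v (conversion xo T) T) <= 0)%E.
Proof.
move=> x1 att_x1.
suff le0 : (limn_einf (fun T => payoff v (conversion x1 T) T
                                - payoff v (conversion xo T) T) <= 0)%E.
  by split=> //; rewrite /overtakes ltNge le0.
(* The bound [0] is rewritten as the lower limit of the sums in [diff_cvg0], which leaves a
   comparison for each [T]. *)
have [<- _] := cvg_limn_einf_sup diff_cvg0.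
apply: le_limn_einf => T; rewrite sum_natB_fin_num; last exact: xo_fin.
(* Both sides subtract the same payoff of [conversion xo T], so only the first terms remain to be
   compared. *)
apply: leeB => //; apply: (xopt_optimal T).2.
exact/feasible_conversion/reversible.
Qed.
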